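(* Let $k$ be any field and $N\geq 1$. If $X$ is a (nonempty) finite set of points in $\mathbb{P}_k^N$ lying on a quadric, then for all $m\geq 1$ $$\frac{\alpha(I_X^{(m)})}{m}\geq \frac{\alpha(I_X)+N-1}{N}.$$ In particular, this inequality holds for all $m\ge 1$ for any set $X$ of $n\leq \binom{N+2}{2}-1$ points in $\mathbb{P}_k^N$.
   Context: Points of $\mathbb{P}^N_k$ are given by homogeneous coordinates in $k$. A quadric is the zero locus of a nonzero homogeneous polynomial of degree $2$ in $R=k[x_0,\ldots,x_N]$; $X$ lies on it if that polynomial vanishes at every point of $X$. For a finite set $X$ of distinct points, $I_X\subseteq R$ is the homogeneous ideal generated by the homogeneous polynomials vanishing on $X$. For a homogeneous ideal $I$ of $R$: $\alpha(I)$ is the least degree of a nonzero homogeneous polynomial in $I$; $I^{(m)}=\bigcap_{p}(I^mR_p\cap R)$, where $p$ runs over all associated primes of $R/I$ (so for $X=\{p_1,\ldots,p_n\}$, $I_X^{(m)}=\bigcap_i I(p_i)^m$, where $I(p_i)$ is the ideal of the point $p_i$). *)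

(* Defs.v *)
From Stdlib Require Import ClassicalEpsilon.
From HB Require Import structures.
From mathcomp Require Import all_boot all_order all_algebra.
From mathcomp Require Import finmap mpoly.

Set Implicit Arguments.
Unset Strict Implicit.
Unset Printing Implicit Defensive.

Import GRing.Theory.
Local Open Scope ring_scope.
Local Open Scope quotient_scope.

Section ProjectiveSpace.
Variables (k : fieldType) (N : nat).

Record hcoord := HCoord { hval :> 'rV[k]_N.+1; hcoord_neq0 : hval != 0 }.

HB.instance Definition _ := [isSub for hval].
HB.instance Definition _ := [Choice of hcoord by <:].

(* Equality of the lines spanned by u and v, which makes proportionality
   decidable over an arbitrary field; see [proportionalP]. *)
Definition proportional (u v : hcoord) : bool := (val u == val v)%MS.

Lemma proportionalP (u v : hcoord) :
  reflect (exists2 c : k, c != 0 & val v = c *: val u) (proportional u v).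
Proof.
apply: (iffP andP) => [[_ /sub_rVP [c vE]]|[c c0 vE]].
  by exists c => //; apply: contraNneq (hcoord_neq0 v) => c0; rewrite vE c0 scale0r.
by split; rewrite vE ?scalemx_sub // -{1}[val u](scalerK c0) scalemx_sub.
Qed.

Lemma proportional_refl : reflexive proportional.
Proof. by move=> u; rewrite /proportional submx_refl. Qed.

Lemma proportional_sym : ssrbool.symmetric proportional.
Proof. by move=> u v; rewrite /proportional andbC. Qed.

Lemma proportional_trans : transitive proportional.
Proof.
move=> v u w /andP[uv vu] /andP[vw wv]; apply/andP; split.
  exact: submx_trans uv vw.
exact: submx_trans wv vu.
Qed.

Canonical proportional_equiv :=
  EquivRel proportional proportional_refl proportional_sym proportional_trans.

(* The k-rational points of P^N. *)
Definition projective_point := {eq_quot proportional}.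
HB.instance Definition _ := Choice.on projective_point.

(* v is a vector of homogeneous coordinates of P. *)
Definition represents (v : hcoord) (P : projective_point) : Prop :=
  \pi_({eq_quot proportional}) v = P.

End ProjectiveSpace.

Section Ideals.
Variable R : comNzRingType.
Implicit Types (I J P S : R -> Prop).

Definition is_ideal I : Prop :=
  [/\ I 0, forall f g, I f -> I g -> I (f + g) & forall a f, I f -> I (a * f)].

Definition ideal_gen S (f : R) : Prop :=
  exists (n : nat) (a s : 'I_n -> R),
    (forall i, S (s i)) /\ f = \sum_(i < n) a i * s i.

Definition ideal_exp I (m : nat) : R -> Prop :=
  ideal_gen (fun f => exists s : 'I_m -> R,
    (forall i, I (s i)) /\ f = \prod_(i < m) s i).

Definition is_prime_ideal P : Prop :=
  [/\ is_ideal P, ~ P 1 & forall f g, P (f * g) -> P f \/ P g].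

(* P is an associated prime of the module R/I, that is, a prime ideal which
   is the annihilator of the class of some h in R/I. *)
Definition is_associated_prime I P : Prop :=
  is_prime_ideal P /\ exists h : R, forall f, P f <-> I (f * h).

End Ideals.

Section SymbolicPower.
Variable R : idomainType.
Implicit Types (I J P : R -> Prop).

Local Notation "x %:F" := (tofrac x).

(* The localization R_P, as a subring of the fraction field of R. *)
Definition localization P (x : {fraction R}) : Prop :=
  exists a s : R, ~ P s /\ x = a%:F / s%:F.

(* J R_P, the ideal of R_P generated by the image of J. *)
Definition extension P J (x : {fraction R}) : Prop :=
  exists (n : nat) (c : 'I_n -> {fraction R}) (j : 'I_n -> R),
    [/\ forall i, localization P (c i), forall i, J (j i)
      & x = \sum_(i < n) c i * (j i)%:F].

Definition symbolic_power I (m : nat) (f : R) : Prop :=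
  forall P, is_associated_prime I P -> extension P (ideal_exp I m) f%:F.

End SymbolicPower.

Section Alpha.
Variables (k : fieldType) (n : nat).
Implicit Types (I : {mpoly k[n]} -> Prop).

Definition has_form I (d : nat) : Prop :=
  exists p : {mpoly k[n]}, [/\ p != 0, p \is d.-homog & I p].

Definition is_initial_degree I (d : nat) : Prop :=
  has_form I d /\ forall e, has_form I e -> (d <= e)%N.

(* Unspecified when I = 0. *)
Definition alpha I : nat := epsilon (inhabits 0%N) (is_initial_degree I).

End Alpha.

Section PointIdeals.
Variables (k : fieldType) (N : nat).
Implicit Types (X : {fset projective_point k N}) (p : {mpoly k[N.+1]}).

(* Only meaningful for homogeneous p, for which the choice of homogeneous
   coordinates is irrelevant. *)
Definition vanishes_at p (P : projective_point k N) : Prop :=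
  forall v : hcoord k N, represents v P -> p.@[fun i => val v 0 i] = 0.

Definition vanishes_on p X : Prop := forall P, P \in X -> vanishes_at p P.

Definition lies_on_quadric X : Prop :=
  exists q : {mpoly k[N.+1]}, [/\ q != 0, q \is 2.-homog & vanishes_on q X].

Definition ideal_of_points X : {mpoly k[N.+1]} -> Prop :=
  ideal_gen (fun p => p \is homog mdeg /\ vanishes_on p X).

End PointIdeals.

(* Main.v *)
(* X lies on a quadric, so alpha(I_X) is 1 or 2.  A form f of degree d in
   I_X^(m) vanishes to order m at every point of X, which means that, in any
   coordinates where the i-th coordinate point lies in X, every monomial x^a of
   f has d - a_i >= m.  Hence d >= m, which settles alpha(I_X) = 1.  If
   alpha(I_X) = 2, no hyperplane contains X, so N + 1 points of X can be moved
   to the coordinate points, and summing the inequalities over i gives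
   N d >= (N + 1) m.  The second part reduces to the first: there are more
   quadratic monomials than conditions imposed by X. *)
From Stdlib Require Import ClassicalEpsilon.
From HB Require Import structures.
Require Import Defs.
From mathcomp Require Import all_boot all_order all_algebra.
From mathcomp Require Import finmap mpoly.

Set Implicit Arguments.
Unset Strict Implicit.
Unset Printing Implicit Defensive.

Import Order.TTheory GRing.Theory Num.Theory.
Local Open Scope ring_scope.

(** * Substitutions: restriction to a line, change of coordinates, order at a coordinate point *)

Lemma mpoly_rmorph_ext (n : nat) (R S : comNzRingType)
    (f g : {rmorphism {mpoly R[n]} -> S}) :
  (forall c, f c%:MP = g c%:MP) -> (forall i, f 'X_i = g 'X_i) -> f =1 g.
Proof.
move=> fgC fgX p; rewrite [p]mpolyE !rmorph_sum; apply: eq_bigr => m _.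
rewrite -mul_mpolyC !rmorphM fgC mpolyXE_id !rmorph_prod; congr (_ * _).
by apply: eq_bigr => i _; rewrite !rmorphXn /= fgX.
Qed.

Section Substitutions.
Variables (k : fieldType) (n : nat).
Implicit Types (f g p q : {mpoly k[n]}) (v : 'rV[k]_n) (i j : 'I_n).

(* Restriction to the line spanned by v, with x_i as parameter: for v <> 0 its
   kernel is the homogeneous ideal of the point v, which over a finite field is
   smaller than the set of polynomials vanishing on that line. *)
Definition line_restr v i : {mpoly k[n]} -> {mpoly k[n]} :=
  mmap (@mpolyC n k) (fun j => v 0 j *: 'X_i).

HB.instance Definition _ v i := GRing.RMorphism.on (line_restr v i).

Lemma line_restr_homog v i d p : p \is d.-homog ->
  line_restr v i p = p.@[fun j => v 0 j] *: 'X_i ^+ d.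
Proof.
move=> /dhomogP hp; rewrite /line_restr /mmap mevalE scaler_suml.
rewrite !big_seq; apply: eq_bigr => m /hp <-.
rewrite mul_mpolyC -scalerA; congr (_ *: _); rewrite /mmap1.
under [LHS]eq_bigr do rewrite exprZn.
rewrite scaler_prod; congr (_ *: _).
by rewrite prodrXr /= mdegE.
Qed.

(** Components of different degrees restrict to multiples of different powers of ['X_i], so they
    cannot cancel, whatever the size of the field. *)
Lemma line_restr_eq0 v i f d :
  line_restr v i f = 0 -> (pihomog mdeg d f).@[fun j => v 0 j] = 0.
Proof.
(* This [K] is large enough for the decomposition to exhaust [f] and for [d] to be one of its
   indices. *)
pose K := maxn (msize f) d.+1; have dK : (d < K)%N by rewrite leq_max leqnn orbT.
rewrite {1}(@pihomog_partitionE _ _ mdeg K f) ?leq_maxl// rmorph_sum.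
under eq_bigr do rewrite /= (line_restr_homog v i (pihomogP _ _ _)).
move=> /(congr1 (mcoeff (U_(i) *+ d)%MM)).
rewrite mcoeff0 raddf_sum (bigD1 (Ordinal dK)) //= mpolyXn mcoeffZ mcoeffX.
rewrite eqxx mulr1 big1 ?addr0 // => e ne; rewrite mpolyXn mcoeffZ mcoeffX.
case: eqP => [|_]; last by rewrite mulr0.
move=> /mnmP/(_ i); rewrite !mulmnE mnm1E eqxx !mul1n => ed.
by case/eqP: ne; apply: val_inj.
Qed.

(** For row vectors x this turns f(x) into f(xA), so that row i of [A] becomes the i-th coordinate
    point. *)
Definition lin_subst (A : 'M[k]_n) : {mpoly k[n]} -> {mpoly k[n]} :=
  mmap (@mpolyC n k) (fun j => \sum_l A l j *: 'X_l).

HB.instance Definition _ A := GRing.RMorphism.on (lin_subst A).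

Lemma lin_substX (A : 'M[k]_n) j : lin_subst A 'X_j = \sum_l A l j *: 'X_l.
Proof. by rewrite /lin_subst mmapX mmap1U. Qed.

Lemma lin_substC (A : 'M[k]_n) c : lin_subst A c%:MP = c%:MP.
Proof. by rewrite /lin_subst mmapC. Qed.

Lemma lin_subst_inj (A : 'M[k]_n) : A \in unitmx -> injective (lin_subst A).
Proof.
move=> uA; apply: (can_inj (g := lin_subst (invmx A))) => f.
apply: (@mpoly_rmorph_ext _ _ _ (lin_subst (invmx A) \o lin_subst A) idfun).
  by move=> c /=; rewrite !lin_substC.
move=> j /=; rewrite lin_substX rmorph_sum /=.
under eq_bigr => l _.
  rewrite -mul_mpolyC rmorphM /= lin_substC lin_substX mul_mpolyC scaler_sumr.
  under eq_bigr do rewrite scalerA mulrC.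
  over.
rewrite exchange_big /=; under eq_bigr do rewrite -scaler_suml.
rewrite (bigD1 j) //= [X in _ + X]big1 => [|l lj].
  have := mulVmx uA => /matrixP/(_ j j); rewrite !mxE eqxx => ->.
  by rewrite scale1r addr0.
have := mulVmx uA => /matrixP/(_ l j); rewrite !mxE (negPf lj) => ->.
by rewrite scale0r.
Qed.

Lemma dhomog_mmap1 (h : 'I_n -> {mpoly k[n]}) (m : 'X_{1..n}) :
  (forall j, h j \is 1.-homog) -> mmap1 h m \is (mdeg m).-homog.
Proof.
move=> hh; rewrite /mmap1 mdegE.
apply: (big_rec2 (fun p d => p \is d.-homog)) => [|j d p _ hp].
  exact: dhomog1.
by apply: dhomogM => //; have := dhomogMn (m j) (hh j); rewrite mul1n.
Qed.

Lemma lin_subst_homog (A : 'M[k]_n) d p :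
  p \is d.-homog -> lin_subst A p \is d.-homog.
Proof.
move=> /dhomogP hp; rewrite /lin_subst /mmap big_seq rpred_sum // => m /hp <-.
rewrite mul_mpolyC; apply/rpredZ/dhomog_mmap1 => j.
by rewrite rpred_sum // => l _; rewrite rpredZ // dhomogX /= mdeg1.
Qed.

(* Multiplying every variable but the i-th by t makes the order in t of the
   image of q the order of vanishing of q at the i-th coordinate point. *)
Definition shrink i : {mpoly k[n]} -> {poly {mpoly k[n]}} :=
  mmap (polyC \o @mpolyC n k) (fun j => ('X_j)%:P * 'X^(j != i)).

HB.instance Definition _ i := GRing.RMorphism.on (shrink i).

Lemma shrinkX i j : shrink i 'X_j = ('X_j)%:P * 'X^(j != i).
Proof. by rewrite /shrink mmapX mmap1U. Qed.

Lemma shrinkC i c : shrink i c%:MP = (c%:MP)%:P.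
Proof. by rewrite /shrink mmapC. Qed.

Lemma shrinkE i q : shrink i q =
  \sum_(a <- msupp q) (q@_a *: 'X_[a])%:P * 'X^(mdeg a - a i).
Proof.
rewrite /shrink /mmap; apply: eq_bigr => a _ /=.
rewrite -mul_mpolyC polyCM -mulrA; congr (_ * _); rewrite /mmap1.
under eq_bigr do rewrite exprMn -rmorphXn -exprM.
rewrite big_split /= -rmorph_prod -mpolyXE_id; congr (_ * _).
rewrite prodrXr mdegE (bigD1 i) //= eqxx mul0n add0n [in RHS](bigD1 i) //= addKn.
by congr ('X^_); apply: eq_bigr => j ->; rewrite mul1n.
Qed.

(** Each monomial only gets multiplied by a power of t, so nothing cancels and divisibility by t^m
    can be read off monomial by monomial. *)
Lemma shrink_msupp i q r m a : shrink i q = r * 'X^m -> a \in msupp q ->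
  (m + a i <= mdeg a)%N.
Proof.
move=> qr aq; have ai : (a i <= mdeg a)%N by rewrite mdegE (bigD1 i) //= leq_addr.
rewrite addnC -leq_subRL // leqNgt; apply/negP => lt.
have := congr1 (fun u : {poly _} => u`_(mdeg a - a i)@_a) qr.
rewrite coefMXn lt mcoeff0 shrinkE coef_sum raddf_sum /=.
rewrite (bigD1_seq a) ?msupp_uniq //= big1 => [|b ba].
  rewrite coefMXn ltnn subnn coefC eqxx mcoeffZ mcoeffX eqxx mulr1 addr0.
  by move/eqP; rewrite mcoeff_eq0 aq.
rewrite coefMXn; case: ifP => _; rewrite ?mcoeff0 // coefC.
by case: eqP; rewrite ?mcoeff0 // mcoeffZ mcoeffX (negPf ba) mulr0.
Qed.

Lemma shrink_lin_substD (A : 'M[k]_n) i f g :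
  shrink i (lin_subst A (f + g)) =
  shrink i (lin_subst A f) + shrink i (lin_subst A g).
Proof. by rewrite [lin_subst _ _]rmorphD rmorphD. Qed.

Lemma shrink_lin_substM (A : 'M[k]_n) i f g :
  shrink i (lin_subst A (f * g)) =
  shrink i (lin_subst A f) * shrink i (lin_subst A g).
Proof. by rewrite [lin_subst _ _]rmorphM rmorphM. Qed.

(** At t = 0 only the i-th variable survives, and the substitution then runs along the line of row
    i. Hence vanishing at that point amounts to divisibility by t. *)
Lemma shrink_lin_subst_coef0 (A : 'M[k]_n) i f :
  (shrink i (lin_subst A f))`_0 = line_restr (row i A) i f.
Proof.
rewrite -horner_coef0.
apply: (@mpoly_rmorph_ext _ _ _ (horner_eval 0 \o shrink i \o lin_subst A)
  (line_restr (row i A) i)) => [c|j] /=; rewrite /horner_eval /line_restr.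
  by rewrite lin_substC shrinkC mmapC hornerC.
rewrite lin_substX mmapX mmap1U rmorph_sum /= horner_sum (bigD1 i) //=.
rewrite big1 => [|l li]; rewrite -mul_mpolyC rmorphM /= shrinkC shrinkX.
  by rewrite eqxx expr0 mulr1 addr0 -polyCM hornerC mul_mpolyC mxE.
by rewrite li expr1 hornerM hornerM hornerX !mulr0.
Qed.

End Substitutions.

(** ['X] is prime and does not divide [a], so its powers can be extracted from [b] one factor at a
    time. *)
Lemma poly_dvdXn_cancel (R : idomainType) (a b r : {poly R}) m :
  a`_0 != 0 -> a * b = r * 'X^m -> exists r', b = r' * 'X^m.
Proof.
move=> a0; elim: m b r => [|m IH] b r; first by exists b; rewrite expr0 mulr1.
move=> ab; have : a`_0 * b`_0 = 0 by rewrite -coef0M ab exprSr mulrA coefMX.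
move/eqP; rewrite mulf_eq0 (negPf a0) /= => b0.
have /factor_theorem[b' bE] : root b 0 by rewrite rootE horner_coef0.
rewrite subr0 in bE; have /(mulIf (negbT (polyX_eq0 R))) : a * b' * 'X = r * 'X^m * 'X.
  by rewrite -mulrA -bE ab exprSr mulrA.
by move=> /IH[r' b'E]; exists r'; rewrite bE b'E exprSr mulrA.
Qed.

(** * Values of forms at points, and forms separating points *)

Section Points.
Variables (k : fieldType) (N : nat).
Implicit Types (P Q : projective_point k N) (X : {fset projective_point k N}).
Implicit Types (v w : hcoord k N) (p h f : {mpoly k[N.+1]}) (i : 'I_N.+1).

Local Notation "p .at v" := (p.@[fun j => (v : 'rV[k]_N.+1) 0 j])
  (at level 10, v at level 9).

Lemma meval_homog_scale p d c (u : 'rV[k]_N.+1) :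
  p \is d.-homog -> p .at (c *: u) = c ^+ d * p .at u.
Proof.
move=> /dhomogP hp; rewrite !mevalE mulr_sumr !big_seq.
apply: eq_bigr => m /hp <-; rewrite mulrCA; congr (_ * _) => /=.
under eq_bigr do rewrite mxE exprMn.
by rewrite big_split /= prodrXr mdegE.
Qed.

Lemma represents_repr P : represents (repr P) P.
Proof. exact: reprK. Qed.

Lemma vanishes_atP p d P v : p \is d.-homog -> represents v P ->
  vanishes_at p P <-> p .at v = 0.
Proof.
move=> hp vP; split=> [|pv w wP]; first exact.
have /eqmodP/proportionalP[c _ ->] : (v = w %[mod {eq_quot @proportional k N}])%qT.
  by rewrite [LHS]vP [RHS]wP.
by rewrite (meval_homog_scale _ _ hp) pv mulr0.
Qed.

Lemma linear_form (u : 'cV[k]_N.+1) : exists l : {mpoly k[N.+1]},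
  [/\ l \is 1.-homog, forall j, l@_U_(j) = u j 0
    & forall v : 'rV[k]_N.+1, l .at v = (v *m u) 0 0].
Proof.
exists (\sum_j u j 0 *: 'X_j); split=> [|j|v].
- by rewrite rpred_sum // => j _; rewrite rpredZ // dhomogX /= mdeg1.
- rewrite raddf_sum (bigD1 j) //= big1 => [|l lj]; rewrite mcoeffZ mcoeffX.
    by rewrite eqxx mulr1 addr0.
  by rewrite eq_mnm1 (negPf lj) mulr0.
rewrite raddf_sum mxE; apply: eq_bigr => j _ /=.
by rewrite mevalZ mevalXU mulrC.
Qed.

Lemma separating_linear_form P Q : P != Q -> exists l : {mpoly k[N.+1]},
  [/\ l \is 1.-homog, l .at (repr P) != 0 & l .at (repr Q) = 0].
Proof.
move=> PQ.
have nPQ : ~~ (val (repr P) <= val (repr Q))%MS.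
  apply: contra PQ => /sub_rVP[c PE].
  have c0 : c != 0.
    by apply: contraNneq (hcoord_neq0 (repr P)) => c0; rewrite PE c0 scale0r.
  rewrite -[P]reprK -[Q]reprK eq_sym.
  by apply/eqP/eqmodP/proportionalP; exists c.
(* The columns of [cokermx] are linear forms vanishing at Q; one of them is nonzero at P, which lies
   outside the span of Q. *)
have /matrix0Pn[a [j]] : val (repr P) *m cokermx (val (repr Q)) != 0.
  by rewrite -submxE.
rewrite [a]ord1 => Pj.
have [l [hl _ lE]] := linear_form (col j (cokermx (val (repr Q)))).
exists l; split=> //; rewrite lE colE mulmxA -colE mxE //.
by rewrite mulmx_coker mxE.
Qed.

(** Take the product of linear forms separating P from each of the other points. *)
Lemma separating_form P (s : seq (projective_point k N)) : exists d h,
  [/\ h \is d.-homog, h .at (repr P) != 0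
    & forall Q, Q \in s -> Q != P -> h .at (repr Q) = 0].
Proof.
elim: s => [|Q s [d [h [hh hP hs]]]].
  by exists 0%N, 1; split; rewrite ?dhomog1 // meval1 oner_neq0.
have [QP|QP] := eqVneq Q P.
  exists d, h; split=> // R; rewrite inE QP => /orP[/eqP -> /eqP //|].
  exact: hs.
have [l [hl lP lQ]] := separating_linear_form (introN eqP (nesym (elimN eqP QP))).
exists (1 + d)%N, (l * h); split=> [||R].
- exact: dhomogM.
- by rewrite mevalM mulf_neq0.
rewrite inE mevalM => /orP[/eqP -> _|Rs RP]; first by rewrite lQ mul0r.
by rewrite hs // mulr0.
Qed.

(** * The ideal of a set of points and its associated primes *)

Lemma ideal_of_points_form X p d :
  p \is d.-homog -> vanishes_on p X -> ideal_of_points X p.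
Proof.
move=> hp pX; exists 1%N, (fun=> 1), (fun=> p); split.
  by move=> _; split => //; exact: homogE hp.
by rewrite big_ord1 mul1r.
Qed.

Lemma line_restr_ideal_of_points X P v i f : P \in X -> represents v P ->
  ideal_of_points X f -> line_restr (val v) i f = 0.
Proof.
move=> PX vP [n [a [s [hs ->]]]]; rewrite rmorph_sum big1 // => r _.
have [/homogP[d hd] /(_ _ PX v vP) sv] := hs r.
by rewrite rmorphM /= (line_restr_homog _ _ hd) sv scale0r mulr0.
Qed.

(** Since the ideal is generated by forms, [f] is split into components: each of them vanishes at P,
    and [h] takes care of the other points. *)
Lemma ideal_of_points_mul X P v i d h f : represents v P -> h \is d.-homog ->
  (forall Q, Q \in X -> Q != P -> h .at (repr Q) = 0) ->
  line_restr (val v) i f = 0 -> ideal_of_points X (f * h).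
Proof.
move=> vP hd hX fv.
exists (msize f), (fun=> 1), (fun e => pihomog mdeg e f * h); split; last first.
  under eq_bigr do rewrite mul1r.
  by rewrite -mulr_suml -(@pihomog_partitionE _ _ mdeg).
move=> e; have he := dhomogM (pihomogP mdeg e f) hd.
split=> [|Q QX]; first exact: homogE he.
have [->|QP] := eqVneq Q P.
  by apply/(vanishes_atP he vP); rewrite mevalM (line_restr_eq0 _ fv) mul0r.
by apply/(vanishes_atP he (represents_repr Q)); rewrite mevalM hX // mulr0.
Qed.

(** The kernel of a morphism into a domain is prime. It is the annihilator of a form [h] that
    vanishes on X except at P: [h] restricts to a nonzero multiple of a power of ['X_i], which can
    be cancelled. *)
Lemma associated_prime_of_point X P v i : P \in X -> represents v P ->
  is_associated_prime (ideal_of_points X) (fun f => line_restr (val v) i f = 0).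
Proof.
move=> PX vP; split; first split.
- split=> [|f g fv gv|a f fv]; first exact: rmorph0.
    by rewrite rmorphD /= fv gv addr0.
  by rewrite rmorphM /= fv mulr0.
- by rewrite rmorph1; apply/eqP/oner_neq0.
- move=> f g; rewrite rmorphM => /eqP; rewrite mulf_eq0.
  by case/orP=> /eqP; [left|right].
have [d [h [hh hP hX]]] := separating_form P (enum_fset X).
exists h => f; split; first exact: ideal_of_points_mul vP hh hX.
move=> /(line_restr_ideal_of_points i PX vP)/eqP.
rewrite rmorphM mulf_eq0 => /orP[/eqP //|/eqP] /=.
rewrite (line_restr_homog _ _ hh) => /eqP; rewrite scaler_eq0.
rewrite expf_eq0 -msupp_eq0 msuppX andbF orbF => /eqP hv.
by case/eqP: hP; apply/(vanishes_atP hh (represents_repr P))/(vanishes_atP hh vP).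
Qed.

(** * Order of vanishing of elements of the symbolic powers *)

Lemma shrink_ideal_exp X P v (A : 'M[k]_N.+1) i m f :
  P \in X -> represents v P -> row i A = val v ->
  ideal_exp (ideal_of_points X) m f ->
  exists r, shrink i (lin_subst A f) = r * 'X^m.
Proof.
move=> PX vP Ai [n [a [s [hs ->]]]].
pose D g := exists r, shrink i (lin_subst A g) = r * 'X^m.
apply: (big_ind D) => [|g h [r gr] [r' hr']|l _].
- by exists 0; rewrite !rmorph0 mul0r.
- by exists (r + r'); rewrite shrink_lin_substD gr hr' mulrDl.
have [u [uI ->]] := hs l.
suff [r rE] : exists r, shrink i (lin_subst A (\prod_(j < m) u j)) = r * 'X^m.
  by exists (shrink i (lin_subst A (a l)) * r); rewrite shrink_lin_substM rE mulrA.
elim: m u uI {D hs} => [|m IH] u uI.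
  by exists 1; rewrite big_ord0 !rmorph1 expr0 mulr1.
rewrite big_ord_recl shrink_lin_substM.
have [r ->] := IH _ (fun j => uI (lift ord0 j)).
(* Each of the m factors vanishes at P and so contributes one factor t. *)
have /factor_theorem[r' ->] : root (shrink i (lin_subst A (u ord0))) 0.
  rewrite rootE horner_coef0 shrink_lin_subst_coef0 Ai.
  by apply/eqP; exact: line_restr_ideal_of_points PX vP (uI _).
by exists (r' * r); rewrite subr0 exprS mulrACA.
Qed.

(** Only the localization at the prime of P is used. Clearing denominators gives s f = g with s
    outside that prime and the image of g divisible by t^m; t does not divide the image of s, so t^m
    divides that of f. *)
Lemma shrink_symbolic_power X P v (A : 'M[k]_N.+1) i m f :
  P \in X -> represents v P -> row i A = val v ->
  symbolic_power (ideal_of_points X) m f ->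
  exists r, shrink i (lin_subst A f) = r * 'X^m.
Proof.
move=> PX vP Ai /(_ _ (associated_prime_of_point i PX vP)) [n [c [j [hc hj fE]]]].
(* This property passes to sums because a product of denominators outside the prime stays outside
   it. *)
pose D x := exists s g r, [/\ line_restr (val v) i s <> 0,
  tofrac s * x = tofrac g & shrink i (lin_subst A g) = r * 'X^m].
suff [s [g [r [sv sf gr]]]] : D (tofrac f).
  have sfg : s * f = g by apply/eqP; rewrite -tofrac_eq tofracM sf.
  apply: (@poly_dvdXn_cancel _ (shrink i (lin_subst A s)) _ r).
    by rewrite shrink_lin_subst_coef0 Ai; apply/eqP.
  by rewrite -shrink_lin_substM sfg.
rewrite fE; apply: (big_ind D) => [|x y|l _].
- exists 1, 0, 0; rewrite tofrac0 mulr0 !rmorph0 mul0r rmorph1.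
  by split=> //; apply/eqP/oner_neq0.
- move=> [s [g [r [sv sg gr]]]] [s' [g' [r' [sv' sg' gr']]]].
  exists (s * s'), (s' * g + s * g').
  exists (shrink i (lin_subst A s') * r + shrink i (lin_subst A s) * r'); split.
  + by rewrite rmorphM; apply/eqP/mulf_neq0; apply/eqP.
  + by rewrite tofracD !tofracM -sg -sg' mulrDr [tofrac s * tofrac s']mulrC
      -[in LHS]mulrA [tofrac s' * tofrac s]mulrC -!mulrA.
  + rewrite shrink_lin_substD 2!shrink_lin_substM gr gr' mulrDl -!mulrA.
    reflexivity.
have [a [s [sv ->]]] := hc l; have [r jr] := shrink_ideal_exp PX vP Ai (hj l).
exists s, (a * j l), (shrink i (lin_subst A a) * r); split=> //.
  have s0 : tofrac s != 0.
    by rewrite tofrac_eq0; apply: contra_notN sv => /eqP ->; rewrite rmorph0.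
  by rewrite tofracM mulrA mulrCA divff // mulr1.
by rewrite shrink_lin_substM jr mulrA.
Qed.

Lemma msupp_symbolic_power X P v (A : 'M[k]_N.+1) i m f a :
  P \in X -> represents v P -> row i A = val v ->
  symbolic_power (ideal_of_points X) m f -> a \in msupp (lin_subst A f) ->
  (m + a i <= mdeg a)%N.
Proof.
move=> PX vP Ai fm; have [r] := shrink_symbolic_power PX vP Ai fm.
exact: shrink_msupp.
Qed.

(** * Degree bounds from points moved to coordinate points *)

Lemma symbolic_power_form (A : 'M[k]_N.+1) I m d : A \in unitmx ->
  has_form (symbolic_power I m) d -> exists f a,
  [/\ symbolic_power I m f, a \in msupp (lin_subst A f) & mdeg a = d].
Proof.
move=> uA [f [f0 fd fm]].
have g0 : lin_subst A f != 0.
  by rewrite -(rmorph0 (lin_subst A)) (inj_eq (lin_subst_inj uA)).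
exists f, (mlead (lin_subst A f)); split; rewrite ?mlead_supp //.
exact: dhomog_mf (lin_subst_homog A fd) _ (mlead_supp g0).
Qed.

(** Completes P to a basis: Gaussian elimination writes a nonzero row as a scalar multiple of the
    first row of its invertible [row_ebase]. *)
Lemma represents_row P : exists (A : 'M[k]_N.+1) v,
  [/\ A \in unitmx, represents v P & row 0 A = val v].
Proof.
set u := val (repr P); pose A := row_ebase u.
have uE : u = col_ebase u 0 0 *: row 0 A.
  rewrite -{1}(mulmx_ebase u) rank_rV hcoord_neq0 -/A.
  rewrite [col_ebase u]mx11_scalar -mulmxA mul_scalar_mx mxE; congr (_ *: _).
  rewrite rowE; congr (_ *m _); apply/matrixP => a b.
  by rewrite !mxE [a]ord1 /= andbT eq_sym.
have c0 : col_ebase u 0 0 != 0.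
  by apply: contraNneq (hcoord_neq0 (repr P)) => c0; rewrite -/u uE c0 scale0r.
have A0 : row 0 A != 0.
  by apply: contraNneq (hcoord_neq0 (repr P)) => A0; rewrite -/u uE A0 scaler0.
exists A, (HCoord A0); split; rewrite ?row_ebase_unit //.
rewrite /represents -[RHS]reprK; apply/eqmodP/proportionalP.
by exists (col_ebase u 0 0).
Qed.

Lemma symbolic_power_degree X m d : X != fset0 ->
  has_form (symbolic_power (ideal_of_points X) m) d -> (m <= d)%N.
Proof.
move=> /fset0Pn[P PX]; have [A [v [uA vP Av]]] := represents_row P.
move=> /(symbolic_power_form uA)[f [a [fm af <-]]].
exact: leq_trans (leq_addr _ _) (msupp_symbolic_power PX vP Av fm af).
Qed.

(** Stack coordinates of all points of X as rows. If the columns are dependent, a nonzero column of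
    the cokernel is a linear form vanishing on X; otherwise some N + 1 rows form an invertible
    matrix. *)
Lemma spanning_points X : ~ has_form (ideal_of_points X) 1 ->
  exists (A : 'M[k]_N.+1) (P : 'I_N.+1 -> projective_point k N),
  [/\ A \in unitmx, forall i, P i \in X & forall i, row i A = val (repr (P i))].
Proof.
move=> noline; pose pt (r : 'I_#|{: X}|) := fsval (enum_val r).
pose M := \matrix_(r < #|{: X}|) val (repr (pt r)).
suff fM : row_full M.
  exists (rowsub (fullrankfun fM) M), (pt \o fullrankfun fM).
  split=> [|i|i]; rewrite ?fullrowsub_unit //; first exact: fsvalP.
  by rewrite row_rowsub rowK.
rewrite -cokermx_eq0; apply/negPn/negP => /matrix0Pn[b [c Mbc]]; apply: noline.
have [l [hl lu lv]] := linear_form (col c (cokermx M)).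
exists l; split=> //.
  by apply: contraNneq Mbc => l0; have := lu b; rewrite l0 mcoeff0 mxE => <-.
apply: (ideal_of_points_form hl) => P PX.
apply/(vanishes_atP hl (represents_repr P)); rewrite lv.
have -> : val (repr P) = row (enum_rank [` PX]%fset) M.
  by rewrite rowK /pt enum_rankK.
by rewrite colE mulmxA -row_mul mulmx_coker row0 mul0mx mxE.
Qed.

Lemma symbolic_power_degree_span X m d : ~ has_form (ideal_of_points X) 1 ->
  has_form (symbolic_power (ideal_of_points X) m) d -> (N.+1 * m <= N * d)%N.
Proof.
move=> /spanning_points[A [P [uA PX AP]]].
move=> /(symbolic_power_form uA)[f [a [fm af ad]]].
have : (\sum_(i < N.+1) (m + a i) <= \sum_(i < N.+1) d)%N.
  apply: leq_sum => i _; rewrite -ad.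
  exact: msupp_symbolic_power (PX i) (represents_repr _) (AP i) fm af.
(* The exponents of the monomial add up to d, which cancels one of the N + 1 copies of d on the
   right. *)
rewrite big_split /= -mdegE ad !sum_nat_const card_ord.
by rewrite [(_ * d)%N]mulSn addnC leq_add2l.
Qed.

(** * Existence and nonexistence of forms of given degree *)

Definition eval_points X d (p : dhomog N.+1 k d) : 'rV[k]_#|{: X}| :=
  \row_r (mpoly_of_dhomog p) .at (repr (fsval (enum_val r : X))).

Lemma eval_points_is_linear X d : linear (@eval_points X d).
Proof. by move=> c p q; apply/rowP => r; rewrite !mxE mevalD mevalZ. Qed.

HB.instance Definition _ X d :=
  GRing.isLinear.Build k _ _ _ (@eval_points X d) (@eval_points_is_linear X d).

(** The binomial is the dimension of the space of forms of degree d, so evaluation at one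
    representative of each point has a nonzero kernel. *)
Lemma form_through_points X d : (#|` X| < 'C(d + N, d))%N ->
  exists q : {mpoly k[N.+1]}, [/\ q != 0, q \is d.-homog & vanishes_on q X].
Proof.
move=> Xd; pose F := linfun (@eval_points X d).
have kF : lker F != 0%VS.
  rewrite -dimv_eq0 -lt0n -(ltn_add2r (\dim (F @: fullv))) add0n.
  rewrite -[lker F]capfv limg_ker_dim dimvf.
  apply: leq_ltn_trans (dimvS (subvf _)) _.
  by rewrite dimvf dim_matrix mul1r -cardfE.
have := memv_pick (lker F); rewrite memv_ker lfunE /= => /eqP qX.
exists (vpick (lker F)); split.
- by apply: contraNneq kF => q0; rewrite -vpick0; apply/eqP/val_inj.
- exact: dhomog_is_dhomog.
move=> P PX; apply/(vanishes_atP (dhomog_is_dhomog _) (represents_repr P)).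
by have /rowP/(_ (enum_rank [` PX]%fset)) := qX; rewrite !mxE enum_rankK.
Qed.

(** Excludes the value 0 for [alpha]: a form of degree 0 is a constant, and a constant vanishing at
    a point is 0. *)
Lemma no_constant_form X : X != fset0 -> ~ has_form (ideal_of_points X) 0.
Proof.
move=> /fset0Pn[P PX] [p [p0 hp]].
move=> /(line_restr_ideal_of_points 0 PX (represents_repr P))/eqP.
rewrite (line_restr_homog _ _ hp) expr0 scaler_eq0 oner_eq0 orbF.
have pE : p = (p@_0)%:MP.
  apply/mpolyP => a; rewrite mcoeffC; have [->|a0] := eqVneq a 0%MM.
    by rewrite mulr1.
  by rewrite mulr0 (dhomog_nemf_coeff hp) // mdeg_eq0.
by rewrite pE mevalC => /eqP pC; case/eqP: p0; rewrite pE pC.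
Qed.

(** Ensures that [alpha] of the symbolic power is a true minimum and not an unspecified value; the
    m-th power of a form of the ideal serves, with denominator 1 at every prime. *)
Lemma symbolic_power_has_form X m d : X != fset0 ->
  has_form (ideal_of_points X) d ->
  has_form (symbolic_power (ideal_of_points X) m) (d * m).
Proof.
move=> X0 [p [p0 hp pX]]; exists (p ^+ m); rewrite expf_neq0 ?dhomogMn //.
split=> // Q [[_ Q1 _] _]; exists 1%N, (fun=> 1), (fun=> p ^+ m); split.
- by move=> _; exists 1, 1; rewrite divr1.
- move=> _; exists 1%N, (fun=> 1), (fun=> p ^+ m); split=> [_|].
    by exists (fun=> p); split=> //; rewrite prodr_const card_ord.
  by rewrite big_ord1 mul1r.
by rewrite big_ord1 mul1r.
Qed.

End Points.

(** * Initial degrees and the inequality *)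

Lemma is_initial_degree_alpha (k : fieldType) (n : nat)
    (I : {mpoly k[n]} -> Prop) d :
  has_form I d -> is_initial_degree I (alpha I).
Proof.
move=> Id; apply: epsilon_spec.
(* [epsilon] needs a least degree to exist; making [has_form] boolean by excluded middle lets
   [ex_minnP] find it. *)
pose b e : bool := excluded_middle_informative (has_form I e).
have bP e : reflect (has_form I e) (b e) by exact: sumboolP.
have /ex_minnP[e /bP Ie emin] : exists e, b e by exists d; apply/bP.
by exists e; split=> // e' /bP; exact: emin.
Qed.

Lemma alpha_symbolic_power_ge (k : fieldType) (N m : nat)
    (X : {fset projective_point k N}) : (0 < N)%N -> (0 < m)%N ->
  X != fset0 -> lies_on_quadric X ->
  ((alpha (ideal_of_points X))%:R + N%:R - 1) / N%:R
    <= (alpha (symbolic_power (ideal_of_points X) m))%:R / m%:R :> rat.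
Proof.
move=> N0 m0 X0 [q [q0 hq qX]].
have I2 : has_form (ideal_of_points X) 2.
  by exists q; split=> //; exact: ideal_of_points_form hq qX.
have [Ia amin] := is_initial_degree_alpha I2.
have [Ida _] := is_initial_degree_alpha (symbolic_power_has_form m X0 I2).
set d := alpha (symbolic_power _ _) in Ida *.
(* Clearing denominators leaves (alpha + (N - 1)) m <= d N in the natural numbers, where N >= 1
   keeps the subtraction exact. *)
rewrite ler_pdivrMr ?ltr0n // mulrAC ler_pdivlMr ?ltr0n //.
rewrite -addrA -[1]/(1%:R) -natrB // -natrD -!natrM ler_nat.
(* The quadric leaves only the values 0, 1 and 2 for [alpha]; in the last case minimality rules out
   a linear form through X. *)
have := amin _ I2; case aE: (alpha (ideal_of_points X)) Ia => [|[|[|//]]] Ia _.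
- by case: (no_constant_form X0 Ia).
- by rewrite addnC subnK // mulnC leq_mul2r (symbolic_power_degree X0 Ida) orbT.
have noline : ~ has_form (ideal_of_points X) 1 by move=> /amin; rewrite aE.
have := symbolic_power_degree_span noline Ida.
by rewrite [(d * N)%N]mulnC -{1}(subnK N0) addn1 add2n.
Qed.

Theorem proposition2p6 (k : fieldType) (N : nat) (hN : (1 <= N)%N)
    (X : {fset projective_point k N}) (hX : X != fset0) :
  (lies_on_quadric X ->
     forall m : nat, (1 <= m)%N ->
       (alpha (symbolic_power (ideal_of_points X) m))%:R / m%:R
       >= ((alpha (ideal_of_points X))%:R + N%:R - 1) / N%:R :> rat)
  /\
  ((#|` X| <= 'C(N + 2, 2) - 1)%N ->
     forall m : nat, (1 <= m)%N ->
       (alpha (symbolic_power (ideal_of_points X) m))%:R / m%:R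
       >= ((alpha (ideal_of_points X))%:R + N%:R - 1) / N%:R :> rat).
Proof.
split=> [qX|cX] m m1; first exact: alpha_symbolic_power_ge.
apply: alpha_symbolic_power_ge => //; apply: form_through_points.
(* The binomial is positive, so subtracting 1 makes it strictly smaller, as the dimension count
   requires. *)
by rewrite addnC (leq_ltn_trans cX) // subn1 ltn_predL bin_gt0 leq_addl.
Qed.
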